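(* There exists a measurable set $E \subseteq \mathbb{R}^2$ with $0 < |E| < \infty$ such that $\mathrm{Lip}_{E}(\omega) < \infty$ for all $\omega \in S^1$.
   Context: $S^1 \subset \mathbb{R}^2$ is the unit circle, $|E|$ denotes the Lebesgue measure of $E \subseteq \mathbb{R}^2$, $\mathcal{H}^1$ is one-dimensional Hausdorff measure, and $\chi_E$ is the characteristic function of $E$. For $(\omega,t) \in S^1 \times \mathbb{R}$ let $\ell_{\omega}(t) := \{x \in \mathbb{R}^2 : \langle x, \omega \rangle = t\}$. The (classical) Radon transform of a function $f$ on $\mathbb{R}^2$ in direction $\omega$ is $$R_{\omega}f(t) := \int_{\ell_{\omega}(t)} f \, d\mathcal{H}^1, \qquad t \in \mathbb{R},$$ each function $R_\omega f$ being well-defined in an almost-everywhere sense for $f \in L^1(\mathbb{R}^2)$; in particular $R_{\omega}\chi_E(t) = \mathcal{H}^1(E \cap \ell_{\omega}(t)) \in [0,\infty]$. For a measurable set $E \subseteq \mathbb{R}^2$ and $\omega \in S^1$, $\mathrm{Lip}_E(\omega) \in [0,\infty]$ denotes the Lipschitz constant of the function $R_{\omega}\chi_E$ on $\mathbb{R}$ (equal to $\infty$ if this function is not Lipschitz), with the understanding that $\mathrm{Lip}_E(\omega) := \infty$ if $R_{\omega}\chi_E(t) = \infty$ for any $t \in \mathbb{R}$. *)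

(* Defs.v *)
From HB Require Import structures.
From mathcomp Require Import all_boot all_order all_algebra.
From mathcomp Require Import all_classical all_reals all_analysis.
Set Implicit Arguments.
Unset Strict Implicit.
Unset Printing Implicit Defensive.
Import Order.TTheory GRing.Theory Num.Theory.
Import numFieldNormedType.Exports.
Local Open Scope classical_set_scope.
Local Open Scope ring_scope.

Section Plane.
Context {R : realType}.
Implicit Types (x y w : R * R) (A E : set (R * R)) (t : R).

(* The product measure lives on the Borel sets; its completion is the Lebesgue
   measure of the plane, and the Caratheodory sets below are the Lebesgue
   measurable ones. *)
Definition borel_lebesgue2 :
    {measure set (measurableTypeR R * measurableTypeR R) -> \bar R} :=
  (@lebesgue_measure R \x @lebesgue_measure R)%E.

Definition lebesgue2 : set (R * R) -> \bar R :=
  @completed_measure_extension _ _ _ borel_lebesgue2.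

Definition lebesgue2_measurable : set (set (R * R)) :=
  (borel_lebesgue2^*)%mu.-cara.-measurable.

(* The library's norm on R * R is the sup norm, hence the explicit Euclidean
   structure. *)
Definition dotp x y : R := x.1 * y.1 + x.2 * y.2.

Definition eucl_dist x y : R := Num.sqrt (dotp (x - y) (x - y)).

(* The element 0 is only there to make the diameter of set0 equal to 0. *)
Definition eucl_diam A : \bar R :=
  ereal_sup (0%E |` [set (eucl_dist x y)%:E | x in A & y in A]).

Definition hausdorff1_delta (delta : R) A : \bar R :=
  ereal_inf [set (\sum_(i <oo) eucl_diam (U i))%E | U in
    [set U : (set (R * R))^nat |
      (forall i, (eucl_diam (U i) <= delta%:E)%E) /\ A `<=` \bigcup_i U i]].

(* With this normalization H^1 is the usual length on lines. It is an outer
   measure, defined on all subsets of the plane. *)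
Definition hausdorff1 A : \bar R :=
  ereal_sup [set hausdorff1_delta delta A | delta in [set d : R | 0 < d]].

Definition unit_circle : set (R * R) := [set w | dotp w w = 1].

Definition line w t : set (R * R) := [set x | dotp x w = t].

(* The Radon transform of the characteristic function of E, for every t. *)
Definition radon_indic E w t : \bar R := hausdorff1 (E `&` line w t).

(* The infimum of the empty set is +oo: the non-Lipschitz case. *)
Definition lip_const (f : R -> R) : \bar R :=
  ereal_inf [set K%:E | K in [set K : R | 0 <= K /\ K.-lipschitz f]].

Definition Lip E w : \bar R :=
  if `[< exists t, radon_indic E w t = +oo%E >] then +oo%E
  else lip_const (fun t => fine (radon_indic E w t)).

End Plane.

(* Main.v *)
Require Import Defs.
From HB Require Import structures.
From mathcomp Require Import all_boot all_order all_algebra.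
From mathcomp Require Import all_classical all_reals all_analysis.
From mathcomp Require Import measurable_realfun zify ring lra.
Import Order.TTheory GRing.Theory Num.Theory.
Import numFieldNormedType.Exports.
Local Open Scope classical_set_scope.
Local Open Scope ring_scope.

(** The set is a union of countably many disjoint triangles whose edges have
    only three directions, arranged so that every jump of the Radon transform
    is cancelled.

    For a single triangle the length of the section by a line, as a function
    of the position of the line, is the positive part of a minimum of affine
    functions, unless the lines are parallel to an edge.  In that case it
    jumps by the length of the edge when the line enters the triangle over
    that edge, and then decreases linearly to 0.  The jump disappears when three copies of the
    triangle, reflected and scaled by 1/3, are placed on the other side of the
    line that carries the edge, with one of their edges on that line: the
    three short edges make up the length of the long one.  Each new triangle
    leaves two edges uncompensated, and these are treated in the same way.
    One triangle thus has six children of one ninth of its area, so the total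
    area is finite ([sum_tri_size]).

    It remains to keep lines from meeting too many triangles.  A child may be
    put anywhere along the line that carries the edge of its parent, and the
    n-th triangle is placed at a distance of order (n + 3)! on it.  Each
    triangle is then much further out than all earlier ones, in one of the
    three edge directions.  If w is orthogonal to no edge, the projections on
    w of all but finitely many triangles are pairwise disjoint
    ([Lip_transversal]).  If w is orthogonal to the edges of direction j, the
    same is true after grouping each triangle with its three children across
    its edge of direction j ([Lip_parallel]); in such a cluster the jumps
    cancel ([cluster_lenE]).  In both cases the Radon transform is a sum of
    functions that are Lipschitz with one common constant, and at most one of
    them, apart from finitely many, is nonzero at a given t
    ([Lip_lt_pinfty_pieces]).

    The value of the Radon transform matters for each t, also when the line
    carries edges.  Triangles of positive signed size are therefore closed
    and those of negative signed size open, so that the edge shared by a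
    parent and its children is counted exactly once.  Finally, Hausdorff
    measure on a line is Lebesgue measure ([hausdorff1_isometry]), so that
    sections are measured as intervals. *)

(** * Hausdorff measure on lines *)

Section HausdorffLength.
Context {R : realType}.
Implicit Types (A U : set (R * R)) (delta : R).
Local Open Scope ereal_scope.

Lemma eucl_diam_ge0 A : 0 <= eucl_diam A.
Proof. by apply: ereal_sup_ubound; left. Qed.

Lemma eucl_diam0 : eucl_diam set0 = 0 :> \bar R.
Proof.
apply/eqP; rewrite eq_le eucl_diam_ge0 andbT.
by apply: ge_ereal_sup => _ [->//|[x []]].
Qed.

Lemma eucl_diam_le A (r : R) : (0 <= r)%R ->
  (forall x y, A x -> A y -> (eucl_dist x y <= r)%R) -> eucl_diam A <= r%:E.
Proof.
move=> r0 Ar; apply: ge_ereal_sup => _ [->|[x Ax [y Ay <-]]].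
  by rewrite lee_fin.
by rewrite lee_fin Ar.
Qed.

Lemma eucl_dist_le_diam A (x y : R * R) : A x -> A y ->
  (eucl_dist x y)%:E <= eucl_diam A.
Proof.
by move=> Ax Ay; apply: ereal_sup_ubound; right; exists x => //; exists y.
Qed.

(** With the value +oo on the sets that are too large, the covers of
    [hausdorff1_delta] become arbitrary covers, and the general construction
    of outer measures applies. *)
Definition gauge delta U : \bar R :=
  if eucl_diam U <= delta%:E then eucl_diam U else +oo.

Let gauge_ge0 delta U : 0 <= gauge delta U.
Proof. by rewrite /gauge; case: ifP => // _; apply: eucl_diam_ge0. Qed.

(* Every subset of the plane is measurable here: covers by arbitrary sets are
   allowed. *)
Let plane := g_sigma_algebraType [set: set (R * R)].

Let hausdorff1_deltaE delta : (0 < delta)%R ->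
  hausdorff1_delta delta = @mu_ext _ plane R (gauge delta).
Proof.
move=> d0; apply/funext => A; apply/eqP; rewrite eq_le; apply/andP; split.
  apply: le_ereal_inf_tmp => _ [F [_ AF] <-].
  have [Fd|] := pselect (forall i, eucl_diam (F i) <= delta%:E).
    apply: ereal_inf_lbound; exists F => //.
    by apply: eq_eseriesr => i _; rewrite /gauge Fd.
  move=> /existsNP[i /negP Fi].
  rewrite (eseries_pinfty _ _ (_ : gauge delta (F i) = +oo)) ?leey//.
    by move=> n _; rewrite -ltNye (lt_le_trans _ (gauge_ge0 _ _)).
  by rewrite /gauge (negbTE Fi).
apply: le_ereal_inf_tmp => _ [F [Fd AF] <-].
apply: ereal_inf_lbound; exists F.
  by split=> // i; apply: sub_sigma_algebra.
by apply: eq_eseriesr => i _; rewrite /gauge Fd.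
Qed.

Lemma hausdorff1_delta_subadditive delta : (0 < delta)%R ->
  sigma_subadditive (@hausdorff1_delta R delta).
Proof.
move=> d0; rewrite hausdorff1_deltaE//.
exact: (@mu_ext_sigma_subadditive _ plane R _ (gauge_ge0 delta)).
Qed.

Lemma le_hausdorff1_delta delta : (0 < delta)%R ->
  {homo @hausdorff1_delta R delta : A B / A `<=` B >-> A <= B}.
Proof.
by move=> d0; rewrite hausdorff1_deltaE//; exact: (@le_mu_ext _ plane).
Qed.

Lemma hausdorff1_delta_ge0 delta A : (0 < delta)%R ->
  0 <= hausdorff1_delta delta A.
Proof.
move=> d0; rewrite hausdorff1_deltaE//.
exact: (@mu_ext_ge0 _ plane R _ (gauge_ge0 delta)).
Qed.

Section Isometry.

Variable g : R -> R * R.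
Hypothesis gI : forall u v, eucl_dist (g u) (g v) = `|u - v|%R.

(** Cut the interval into equal pieces of length at most delta. *)
Lemma hausdorff1_delta_itv delta (a b : R) : (0 < delta)%R -> (a <= b)%R ->
  hausdorff1_delta delta (g @` `]a, b]) <= (b - a)%:E.
Proof.
move=> d0 ab.
have [N Nd] : exists N : nat, ((b - a) / delta < N.+1%:R)%R.
  by exists (Num.truncn ((b - a) / delta)); exact: truncnS_gt.
pose h : R := ((b - a) / N.+1%:R)%R.
have h0 : (0 <= h)%R by rewrite divr_ge0 ?subr_ge0.
have hd : (h <= delta)%R.
  by move: Nd; rewrite ltr_pdivrMr// mulrC -ltr_pdivrMr// => /ltW.
pose U (i : nat) : set (R * R) := if (i < N.+1)%N
  then g @` `](a + i%:R * h)%R, (a + i.+1%:R * h)%R]%classic else set0.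
have Ud i : eucl_diam (U i) <= (if (i < N.+1)%N then h%:E else 0).
  rewrite /U; case: ifP => _; last by rewrite eucl_diam0.
  apply: eucl_diam_le => // _ _ [u + <-] [v + <-].
  rewrite /= !in_itv/= gI -addn1 natrD mulrDl mul1r.
  by move=> /andP[? ?] /andP[? ?]; rewrite ler_norml; apply/andP; split; lra.
apply: (@le_trans _ _ (\sum_(i <oo) eucl_diam (U i))).
  apply: ereal_inf_lbound; exists U => //; split.
    by move=> i; apply: (le_trans (Ud i)); case: ifP; rewrite lee_fin// ltW.
  move=> _ [u /= + <-]; rewrite in_itv/= => /andP[au ub].
  have hp : (0 < h)%R by rewrite divr_gt0// subr_gt0 (lt_le_trans au).
  have ex : exists i : nat, (u <= a + i%:R * h)%R.
    exists N.+1; rewrite /h mulrC -mulrA mulVf ?mulr1 ?pnatr_eq0//.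
    by rewrite addrC subrK.
  (* The piece that contains u ends at the first grid point that is not
     below u. *)
  have := ex_minnP ex; case=> m um mmin.
  have m0 : (0 < m)%N.
    by rewrite lt0n; apply/eqP => m0; move: um; rewrite m0 mul0r addr0; lra.
  exists m.-1 => //; rewrite /U prednK//.
  have -> : (m <= N.+1)%N.
    apply: mmin; rewrite /h mulrC -mulrA mulVf ?mulr1 ?pnatr_eq0//.
    by rewrite addrC subrK.
  exists u => //=; rewrite in_itv/= um andbT ltNge; apply/negP => /mmin.
  by rewrite -ltnS prednK// ltnn.
rewrite (nneseries_split _ N.+1); last by move=> *; apply: eucl_diam_ge0.
rewrite [X in _ + X]eseries0 ?adde0; last first.
  by move=> i Ni _; rewrite /U ltnNge add0n in Ni *; rewrite Ni/= eucl_diam0.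
rewrite add0n big_mkord; apply: (@le_trans _ _ (\sum_(i < N.+1) h%:E)).
  by apply: lee_sum => i _; apply: (le_trans (Ud i)); rewrite ltn_ord.
rewrite sumEFin lee_fin sumr_const card_ord -mulr_natr /h -mulrA.
by rewrite mulVf ?mulr1 ?pnatr_eq0.
Qed.

(** Both sides are outer measures.  A cover of A by intervals can be refined
    to pieces of length at most delta without changing the total length;
    conversely the preimage of a set of diameter D lies in an interval of
    length D. *)
Lemma hausdorff1_isometry (A : set R) :
  hausdorff1 (g @` A) = lebesgue_measure A.
Proof.
apply/eqP; rewrite eq_le; apply/andP; split.
  apply: ge_ereal_sup => _ [delta d0 <-].
  apply: le_ereal_inf_tmp => _ [F [mF AF] <-].
  apply: (@le_trans _ _ (\sum_(i <oo) hausdorff1_delta delta (g @` F i))).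
    apply: le_trans (hausdorff1_delta_subadditive _ d0 (fun i => g @` F i)).
    apply: le_hausdorff1_delta => // _ [u /AF[i _ Fu] <-].
    by exists i => //; exists u.
  apply: lee_nneseries => [i _ _|i _]; first exact: hausdorff1_delta_ge0.
  case: (mF i) => -[a b] /= _ <-.
  have [ab|ba] := leP a b; last first.
    rewrite set_itv_ge; last by rewrite bnd_simp -leNgt ltW.
    rewrite image_set0.
    apply: (@le_trans _ _ 0); last by rewrite wlength0.
    apply: ereal_inf_lbound; exists (fun=> set0).
      by split => // i'; rewrite eucl_diam0 lee_fin ltW.
    by rewrite eseries0// => *; rewrite eucl_diam0.
  apply: (le_trans (hausdorff1_delta_itv _ _ _ d0 ab)).
  rewrite wlength_itv/= lte_fin; case: ltP => [_|ba]; first by rewrite EFinB.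
  by rewrite lee_fin; lra.
apply: (@le_trans _ _ (hausdorff1_delta 1 (g @` A))); last first.
  by apply: ereal_sup_ubound; exists 1%R => //=.
apply: le_ereal_inf_tmp => _ [U [Ud AU] <-].
pose mu := ((@wlength R idfun)^*)%mu.
apply: (@le_trans _ _ (\sum_(i <oo) mu (g @^-1` (U i)))).
  apply: le_trans (outer_measure_sigma_subadditive mu (fun i => g @^-1` (U i))).
  apply: (le_outer_measure mu) => u Au.
  by have [i _ Ui] := AU _ (imageP g Au); exists i.
apply: lee_nneseries => [i _ _|i _]; first exact: outer_measure_ge0.
have [[x Vx]|V0] := pselect (g @^-1` (U i) !=set0); last first.
  have -> : g @^-1` (U i) = set0.
    by apply/seteqP; split => // x Vx; apply: V0; exists x.
  rewrite (_ : mu set0 = 0) ?eucl_diam_ge0//; exact: outer_measure0 mu.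
have Di : eucl_diam (U i) \is a fin_num.
  by rewrite ge0_fin_numE ?eucl_diam_ge0// (le_lt_trans (Ud i))// ltry.
rewrite -(fineK Di); set D := fine _.
have VD u v : (g @^-1` (U i)) u -> (g @^-1` (U i)) v -> (`|u - v| <= D)%R.
  by move=> Vu Vv; rewrite -lee_fin fineK// -gI; apply: eucl_dist_le_diam.
set V := g @^-1` (U i).
have lbV : has_inf V.
  split; first by exists x.
  by exists (x - D)%R => y Vy; have := VD _ _ Vx Vy; rewrite ler_norml; lra.
have D0 : (0 <= D)%R by apply: le_trans (VD _ _ Vx Vx).
have VI : V `<=` `[inf V, (inf V + D)%R]%classic.
  move=> y Vy; rewrite /= in_itv/=; apply/andP; split.
    exact: ge_inf lbV.2 _ Vy.
  rewrite -lerBlDr; apply: lb_le_inf; first by exists x.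
  by move=> z Vz; have := VD _ _ Vy Vz; rewrite ler_norml; lra.
apply: (le_trans (le_outer_measure mu _ _ VI)).
have := @lebesgue_measure_itv R `[inf V, (inf V + D)%R].
rewrite /= lte_fin; case: ltP => [_|_].
  by rewrite -EFinB addrAC subrr add0r => <-.
by move=> h; apply: le_trans (_ : 0 <= _); rewrite ?lee_fin// -h.
Qed.

End Isometry.

(** The point of [line w t] with signed distance u from t w. *)
Definition line_point (w : R * R) (t u : R) : R * R :=
  (t * w.1 - u * w.2, t * w.2 + u * w.1)%R.

Lemma radon_indicE A (w : R * R) t : unit_circle w ->
  radon_indic A w t = lebesgue_measure (line_point w t @^-1` A).
Proof.
rewrite /unit_circle/= /dotp => w1.
rewrite /radon_indic -(@hausdorff1_isometry (line_point w t)).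
  congr hausdorff1; apply/seteqP; split => [x [Ax /= xt]|_ [u Au <-]].
    have xE : line_point w t (x.2 * w.1 - x.1 * w.2) = x.
      rewrite /line_point -xt [RHS]surjective_pairing.
      by congr pair; rewrite -[RHS]mulr1 -w1 /dotp; ring.
    by exists (x.2 * w.1 - x.1 * w.2)%R; rewrite //= xE.
  split => //; rewrite /line/= /dotp /line_point/= -[RHS]mulr1 -w1; ring.
move=> u v; rewrite -sqrtr_sqr /eucl_dist; congr Num.sqrt.
rewrite -[RHS]mulr1 -w1 /dotp /line_point/=; ring.
Qed.

End HausdorffLength.

(** * Sums of pieces with separated projections *)

Section Pieces.
Context {R : realType}.

Lemma Lip_lt_pinfty (E : set (R * R)) (w : R * R) (K : R) : (0 <= K)%R ->
  (forall t, radon_indic E w t \is a fin_num) ->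
  (forall t t', `|fine (radon_indic E w t) - fine (radon_indic E w t')|
     <= K * `|t - t'|) ->
  (Lip E w < +oo)%E.
Proof.
move=> K0 Efin EK; rewrite /Lip; case: asboolP => [[t Et]|_].
  by have := Efin t; rewrite Et.
apply: (@le_lt_trans _ _ K%:E); last by rewrite ltry.
apply: ereal_inf_lbound; exists K => //; split => // -[t t'] _ /=.
exact: EK.
Qed.

(** At t at most one index beyond N contributes, since a piece with a nonzero
    section contains a point of the line.  So a difference of two values of
    the Radon transform consists of the first N terms and at most one more
    term for each of the two lines. *)
Lemma Lip_lt_pinfty_pieces (E : set (R * R)) (X : nat -> set (R * R))
    (f : nat -> R -> R) (w : R * R) (K : R) (N : nat) :
  unit_circle w -> (0 <= K)%R -> E = \bigcup_n X n -> trivIset setT X ->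
  (forall n t, measurable (line_point w t @^-1` X n : set (measurableTypeR R))) ->
  (forall n t, lebesgue_measure (line_point w t @^-1` X n) = (f n t)%:E) ->
  (forall n t t', `|f n t - f n t'| <= K * `|t - t'|) ->
  (forall m n x y, (N <= m)%N -> (N <= n)%N -> X m x -> X n y ->
     dotp x w = dotp y w -> m = n) ->
  (Lip E w < +oo)%E.
Proof.
move=> w1 K0 EX tX mX fX fK sepX.
have dotw t u : dotp (line_point w t u) w = t.
  by rewrite -[RHS]mulr1 -w1 /dotp /line_point/=; ring.
(* [far] gives the only index beyond N that may contribute at t. *)
have far t : exists m, forall n, (N <= n)%N -> n != m -> f n t = 0.
  have [[m [Nm fm]]|nom] := pselect (exists m, (N <= m)%N /\ f m t <> 0).
    exists m => n Nn nm; apply/eqP/negPn/negP => /eqP fn.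
    have point k : f k t <> 0 -> exists u, X k (line_point w t u).
      move=> fk; apply/not_existsP => Xk; apply: fk.
      suff -> : f k t = fine (lebesgue_measure (line_point w t @^-1` X k)).
        rewrite (_ : _ @^-1` _ = set0) ?measure0//.
        by apply/seteqP; split => // u /Xk.
      by rewrite fX.
    have [u Xu] := point _ fm; have [v Xv] := point _ fn.
    by move/eqP: nm; apply; apply: (sepX _ _ _ _ Nn Nm Xv Xu); rewrite !dotw.
  exists 0%N => n Nn _; apply/eqP/negPn/negP => /eqP fn.
  by apply: nom; exists n.
have radonE t L m : (N <= L)%N -> (m < L)%N ->
    (forall n, (N <= n)%N -> n != m -> f n t = 0) ->
    radon_indic E w t = (\sum_(i < L) f i t)%:E.
  move=> NL mL fm; rewrite radon_indicE// EX preimage_bigcup.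
  rewrite measure_semi_bigcup//; last 2 first.
  - apply/trivIsetP => i j _ _ ij; rewrite -preimage_setI.
    by move/trivIsetP : tX => ->//; rewrite preimage_set0.
  - exact: bigcupT_measurable.
  rewrite (nneseries_split _ L); last by move=> *; apply: measure_ge0.
  rewrite [X in (_ + X)%E]eseries0 ?adde0; last first.
    move=> i; rewrite add0n => Li _.
    apply: (etrans (fX _ _)); rewrite fm// ?(leq_trans NL)//.
    by rewrite gtn_eqF// (leq_trans mL).
  by rewrite add0n big_mkord -sumEFin; apply: eq_bigr => i _; exact: fX.
apply: (@Lip_lt_pinfty _ _ (K * (N.+2)%:R)) => [|t|t t'].
- by rewrite mulr_ge0.
- have [m fm] := far t.
  by rewrite (radonE t (N + m.+1)%N m) ?leq_addr// addnS ltnS leq_addl.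
have [m fm] := far t; have [m' fm'] := far t'.
pose L := (N + m.+1 + m'.+1)%N.
have NL : (N <= L)%N by rewrite /L -addnA leq_addr.
have mL : (m < L)%N by rewrite /L; lia.
have mL' : (m' < L)%N by rewrite /L; lia.
rewrite (radonE t L m)// (radonE t' L m')//= -sumrB.
apply: (le_trans (ler_norm_sum _ _ _)).
pose d := K * `|t - t'|.
have d0 : 0 <= d by rewrite mulr_ge0.
apply: (@le_trans _ _ (\sum_(i < L)
    (d * (i < N)%:R + d * (val i == m)%:R + d * (val i == m')%:R))).
  apply: ler_sum => i _; have [iN|Ni] := ltnP i N.
    rewrite mulr1 -addrA; apply: (le_trans (fK _ _ _)).
    by rewrite lerDl addr_ge0// mulr_ge0.
  rewrite mulr0 add0r; have [im|im] := eqVneq (val i) m.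
    apply: (le_trans (fK _ _ _)).
    by rewrite mulr1 lerDl mulr_ge0.
  rewrite mulr0 add0r; have [im'|im'] := eqVneq (val i) m'.
    by rewrite mulr1.
  by rewrite mulr0 fm// fm'// subrr normr0.
rewrite !big_split/= -!mulr_sumr.
have sum1 k : (k < L)%N -> \sum_(i < L) (val i == k)%:R = 1 :> R.
  move=> kL; rewrite (bigD1 (Ordinal kL))//= eqxx big1 ?addr0// => i.
  by move=> /negbTE; rewrite -val_eqE/= => ->.
rewrite !sum1//.
have -> : \sum_(i < L) (i < N)%:R = N%:R :> R.
  rewrite -natr_sum; congr (_%:R).
  rewrite -(big_mkord xpredT (fun i => (i < N)%N : nat)).
  rewrite (big_cat_nat (leq0n N) NL)/= [X in (_ + X)%N]big_nat_cond.
  rewrite [X in (_ + X)%N]big1 ?addn0; last first.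
    by move=> i /andP[/andP[Ni _] _]; rewrite ltnNge Ni.
  rewrite big_nat_cond (eq_bigr (fun=> 1%N)); last by move=> i /andP[/andP[_ ->]].
  by rewrite -big_nat_cond sum_nat_const_nat subn0 muln1.
rewrite /d -!mulrDr [X in _ <= X](_ : _ = K * `|t - t'| * N.+2%:R); last by ring.
by rewrite -addn2 natrD -addrA.
Qed.

End Pieces.

(** * Triangles and their sections *)

Inductive edge := Edge0 | Edge1 | Edge2.

Definition nxt (i : edge) : edge :=
  match i with Edge0 => Edge1 | Edge1 => Edge2 | Edge2 => Edge0 end.

Lemma edge_ind_nxt (P : edge -> Prop) (i : edge) :
  P i -> P (nxt i) -> P (nxt (nxt i)) -> forall j, P j.
Proof. by case: i => /= ? ? ? []. Qed.

Lemma edge3P (i j : edge) : [\/ j = i, j = nxt i | j = nxt (nxt i)].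
Proof. by case: i; case: j; (constructor 1 + constructor 2 + constructor 3). Qed.

Section Triangles.
Context {R : realType}.
Implicit Types (c : edge -> R) (i j : edge) (q w : R * R).

(** The edges of index i are parallel to the kernel of [coord i].  The three
    functionals add up to 0, so the index i can be rotated in all
    statements. *)
Definition coord i q : R :=
  match i with Edge0 => q.1 | Edge1 => q.2 | Edge2 => - q.1 - q.2 end.

Lemma coord_nxt2 i q : coord (nxt (nxt i)) q = - coord i q - coord (nxt i) q.
Proof. by case: i => /=; ring. Qed.

(** The level lines [coord i = c i] bound a triangle; it is a translate of
    tri_size c times the triangle with vertices 0, (1, 0), (0, 1), so a
    negative value means a reflected triangle. *)
Definition tri_size c : R := - (c Edge0 + c Edge1 + c Edge2).

Lemma tri_sizeE c i : tri_size c = - (c i + c (nxt i) + c (nxt (nxt i))).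
Proof. by case: i; rewrite /tri_size /=; ring. Qed.

(** The comparison is an equality of booleans: the triangle is closed if its
    signed size is positive and open otherwise.  Two triangles on different
    sides of a common edge line are then separated by complementary
    conditions, without overlap on the line itself. *)
Definition triangle c : set (R * R) :=
  [set q | forall i, (c i <= coord i q) = (0 < tri_size c)].

Lemma triangle_coord c q i : triangle c q ->
  `|coord i q - c i| <= `|tri_size c|.
Proof.
move=> Tq; have := (Tq i, Tq (nxt i), Tq (nxt (nxt i))).
rewrite coord_nxt2; have := tri_sizeE c i; have [s0|s0] := ltP 0 (tri_size c) => sE.
  by case=> [[h1 h2] h3]; rewrite (gtr0_norm s0) ler_norml; apply/andP; split; lra.
case=> [[/negbT + /negbT +] /negbT]; rewrite -!ltNge => h1 h2 h3.
by rewrite (ler0_norm s0) ler_norml; apply/andP; split; lra.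
Qed.

(** The direction of the lines orthogonal to w. *)
Definition rot w : R * R := (- w.2, w.1).

Lemma coord_line_point i w t u :
  coord i (line_point w t u) = t * coord i w + u * coord i (rot w).
Proof. by case: i => /=; ring. Qed.

(** Closed for b = true, open for b = false, as for the triangles. *)
Definition segment (b : bool) (l h : R) : set R :=
  [set` Interval (BSide b l) (BSide (~~ b) h)].

Lemma segmentE b l h u : segment b l h u <-> (l < u ?<= if b) && (u < h ?<= if b).
Proof. by case: b; rewrite /segment /= in_itv. Qed.

Lemma segment_measurable b l h :
  measurable (segment b l h : set (measurableTypeR R)).
Proof. exact: measurable_itv. Qed.

Lemma segment_measure b l h :
  lebesgue_measure (segment b l h) = (Num.max 0 (h - l))%:E.
Proof.
rewrite /segment lebesgue_measure_itv/= lte_fin.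
case: ltP => lh; first by rewrite max_r ?subr_ge0 ?ltW.
by rewrite max_l ?subr_le0.
Qed.

Lemma halfline b (c x beta u : R) : beta != 0 ->
  (((c <= x + u * beta) = b) <->
   (if (0 < beta) == b then (c - x) / beta < u ?<= if b
    else u < (c - x) / beta ?<= if b)).
Proof.
move=> beta0; rewrite addrC -lerBlDr.
have [bp|bn] := ltP 0 beta.
  rewrite -ler_pdivrMr//; case: b => //=.
  by rewrite ltNge; split => [->//|/negbTE].
have {beta0 bn}bn : beta < 0 by rewrite lt_neqAle beta0.
rewrite -ler_ndivlMr//; case: b => //=.
by rewrite ltNge; split => [->//|/negbTE].
Qed.

Lemma pos_opposite (x y : R) : x * y < 0 -> (0 < y) = ~~ (0 < x).
Proof.
case: (ltgtP x 0) => [x0|x0|->]; last by rewrite mul0r ltxx.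
  by rewrite nmulr_rlt0.
by rewrite pmulr_rlt0// => y0; rewrite lt_gtF.
Qed.

Section LineSection.
(* beta i is the slope of coord i along the line, r i is the parameter at which
   the line crosses the edge line of index i, and b tells whether the triangle
   is closed. *)
Variables (c : edge -> R) (w : R * R) (t : R).
Let beta i := coord i (rot w).
Let r i := (c i - t * coord i w) / beta i.
Let b := 0 < tri_size c.

Let sectionE u : (line_point w t @^-1` triangle c) u <->
  forall i, (c i <= t * coord i w + u * beta i) = b.
Proof. by split => + i => /(_ i); rewrite coord_line_point. Qed.

Let sectionP i u : beta i != 0 -> beta (nxt i) != 0 ->
  beta (nxt (nxt i)) != 0 ->
  (line_point w t @^-1` triangle c) u <->
  [/\ if (0 < beta i) == b then r i < u ?<= if b else u < r i ?<= if b,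
      if (0 < beta (nxt i)) == b then r (nxt i) < u ?<= if b
      else u < r (nxt i) ?<= if b &
      if (0 < beta (nxt (nxt i))) == b then r (nxt (nxt i)) < u ?<= if b
      else u < r (nxt (nxt i)) ?<= if b].
Proof.
move=> b0 b1 b2; split => [/sectionE h|[h0 h1 h2]].
  by split; apply/(halfline b).
by apply/sectionE; apply: (edge_ind_nxt _ i); apply/(halfline b).
Qed.

(** The slopes beta add up to 0, so one of them, that of index i, has the
    opposite sign of the two others.  The edge line of index i bounds the
    section on one side, the two other edge lines on the other side. *)
Lemma triangle_section_transversal i :
  beta i * beta (nxt i) < 0 -> beta i * beta (nxt (nxt i)) < 0 ->
  exists l h, line_point w t @^-1` triangle c = segment b l h /\
   h - l = if (0 < beta i) == b
     then Num.min (r (nxt i) - r i) (r (nxt (nxt i)) - r i)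
     else Num.min (r i - r (nxt i)) (r i - r (nxt (nxt i))).
Proof.
move=> i1 i2.
have b0 : beta i != 0 by apply: contraTneq i1 => ->; rewrite mul0r ltxx.
have b1 : beta (nxt i) != 0 by apply: contraTneq i1 => ->; rewrite mulr0 ltxx.
have b2 : beta (nxt (nxt i)) != 0.
  by apply: contraTneq i2 => ->; rewrite mulr0 ltxx.
have s1 := pos_opposite _ _ i1; have s2 := pos_opposite _ _ i2.
have E u := sectionP i u b0 b1 b2.
rewrite s1 s2 (_ : (~~ _ == b) = ~~ ((0 < beta i) == b)) in E; last first.
  by case: (0 < beta i); case: b.
case: ((0 < beta i) == b) E => /= E.
  exists (r i), (Num.min (r (nxt i)) (r (nxt (nxt i)))); split.
    apply/seteqP; split => u.
      by move=> /E[h0 h1 h2]; apply/segmentE; rewrite lteif_minr h0 h1.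
    by move=> /segmentE; rewrite lteif_minr => /and3P; exact: (E u).2.
  by rewrite addr_minl.
exists (Num.max (r (nxt i)) (r (nxt (nxt i)))), (r i); split.
  apply/seteqP; split => u.
    by move=> /E[h0 h1 h2]; apply/segmentE; rewrite lteif_maxl h1 h2.
  by move=> /segmentE; rewrite lteif_maxl => /andP[/andP[? ?] ?]; apply: (E u).2.
by rewrite oppr_max addr_minr.
Qed.

(** The condition of index i does not depend on the point of the line, and the
    two other edge lines, crossed in opposite senses, bound the section.  Its
    length is proportional to the distance from the opposite vertex. *)
Lemma triangle_section_parallel i : beta i = 0 -> beta (nxt i) != 0 ->
  exists l h, line_point w t @^-1` triangle c =
    (if (c i <= t * coord i w) == b then segment b l h else set0) /\
    ((c i <= t * coord i w) = b ->
     h - l = (`|tri_size c| - `|t * coord i w - c i|) / `|beta (nxt i)|).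
Proof.
move=> bi bn.
have b2E : beta (nxt (nxt i)) = - beta (nxt i).
  by rewrite /beta coord_nxt2 -/(beta i) bi oppr0 sub0r.
have b2 : beta (nxt (nxt i)) != 0 by rewrite b2E oppr_eq0.
have s2 : (0 < beta (nxt (nxt i))) = ~~ (0 < beta (nxt i)).
  by rewrite b2E oppr_gt0; case: ltgtP bn.
have E u : (line_point w t @^-1` triangle c) u <->
    [/\ (c i <= t * coord i w) = b,
      if (0 < beta (nxt i)) == b then r (nxt i) < u ?<= if b
      else u < r (nxt i) ?<= if b &
      if (0 < beta (nxt (nxt i))) == b then r (nxt (nxt i)) < u ?<= if b
      else u < r (nxt (nxt i)) ?<= if b].
  split => [/sectionE h|[h0 h1 h2]].
    by split; [have := h i; rewrite bi mulr0 addr0|apply/(halfline b)..].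
  apply/sectionE; apply: (edge_ind_nxt _ i); last 2 first.
  - by apply/(halfline b).
  - by apply/(halfline b).
  by rewrite bi mulr0 addr0.
have rE : r (nxt (nxt i)) - r (nxt i) =
    (tri_size c - (t * coord i w - c i)) / beta (nxt i).
  rewrite /r b2E coord_nxt2 (tri_sizeE c i); field; exact: bn.
rewrite s2 (_ : (~~ _ == b) = ~~ ((0 < beta (nxt i)) == b)) in E; last first.
  by case: (0 < beta (nxt i)); case: b.
have len : (c i <= t * coord i w) = b ->
    (`|tri_size c| - `|t * coord i w - c i|) / `|beta (nxt i)| =
    (if (0 < beta (nxt i)) == b then 1 else -1) *
    (r (nxt (nxt i)) - r (nxt i)).
  rewrite rE; have -> : `|tri_size c| = if b then tri_size c else - tri_size c.
    by rewrite /b; have [/gtr0_norm|/ler0_norm] := ltP 0 (tri_size c).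
  have -> : `|beta (nxt i)| =
      if 0 < beta (nxt i) then beta (nxt i) else - beta (nxt i).
    by have [/gtr0_norm|/ler0_norm] := ltP 0 (beta (nxt i)).
  case: b => cb.
    rewrite ger0_norm ?subr_ge0//.
    by case: ifP => _ /=; rewrite ?mul1r// invrN mulrN mulN1r.
  rewrite ltr0_norm ?subr_lt0 1?ltNge ?cb//.
  by case: ifP => _ /=; rewrite ?mul1r ?invrN ?mulN1r -?mulrN ?mulrN -?mulNr;
    congr (_ * _); ring.
case: ((0 < beta (nxt i)) == b) E len => /= E len.
  exists (r (nxt i)), (r (nxt (nxt i))); split; last first.
    by move=> /len ->; rewrite mul1r.
  case: eqP => cb; apply/seteqP; split => u //; last by case/E.
    by case/E => _ h1 h2; apply/segmentE; rewrite h1.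
  by move/segmentE => /andP[h1 h2]; apply: (E u).2.
exists (r (nxt (nxt i))), (r (nxt i)); split; last first.
  by move=> /len ->; rewrite mulN1r opprB.
case: eqP => cb; apply/seteqP; split => u //; last by case/E.
  by case/E => _ h1 h2; apply/segmentE; rewrite h2.
by move/segmentE => /andP[h1 h2]; apply: (E u).2.
Qed.

End LineSection.

End Triangles.

(** * The tree of triangles *)

Definition select {A : Type} (i : edge) (x y z : A) (j : edge) : A :=
  match i, j with
  | Edge0, Edge0 | Edge1, Edge1 | Edge2, Edge2 => x
  | Edge0, Edge1 | Edge1, Edge2 | Edge2, Edge0 => y
  | _, _ => z
  end.

Section Tree.
Context {R : realType}.

(** Nodes are numbered by n, and the sides of nodes that still need children
    by q: the root 0 owns the sides 0, 1 and 2, a node n > 0 owns 2 n + 1 and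
    2 n + 2.  The children across the side q are 3 q + 1, 3 q + 2 and
    3 q + 3.  The truncated predecessor gives the side 0 to the root. *)
Definition owner (q : nat) : nat := q.-1./2.

(** The index of the edge that is the side q, if d is the index of the edge
    across which the owner of q was attached; at the root d is Edge0. *)
Definition side (q : nat) (d : edge) : edge :=
  if q is 0%N then Edge0 else if odd q then nxt d else nxt (nxt d).

(** The growth rate is at least 4, which keeps the triangles disjoint, and it
    is unbounded, which separates projections even if w is almost orthogonal
    to an edge. *)
Definition scale (n : nat) : R := (n + 3)`!%:R.

(** The data of the node n + 1, computed from the data p of its parent: it
    shares the edge line of index i with the parent and is moved along this
    line to the level scale (n + 1) of the next coordinate.  The last level is
    the one that makes the signed size equal to - tri_size p.2 / 3. *)
Definition child (n : nat) (p : edge * (edge -> R)) : edge * (edge -> R) :=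
  let i := side (n %/ 3) p.1 in
  (i, select i (p.2 i) (scale n.+1) (tri_size p.2 / 3 - p.2 i - scale n.+1)).

(** The parent of a node is not its structural predecessor, so the recursion
    is on a bound k for n. *)
Fixpoint node_fuel (k n : nat) : edge * (edge -> R) :=
  match n, k with
  | n'.+1, k'.+1 => child n' (node_fuel k' (owner (n' %/ 3)))
  | _, _ => (Edge0, select Edge0 0 0 (-1))
  end.

Definition node (n : nat) := node_fuel n n.

Lemma owner_le n : (owner (n %/ 3) <= n)%N.
Proof. by rewrite /owner; have := leq_div n 3; lia. Qed.

Lemma node_fuelE k n : (n <= k)%N -> node_fuel k n = node n.
Proof.
rewrite /node; move: {2}n (leqnn n) => m.
elim: m k n => [|m IH] k [|n] // nm; [by case: k..|].
case: k => // k nk /=; congr child.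
have on := owner_le n.
by rewrite (IH k) ?(IH n) //; lia.
Qed.

Definition dir n : edge := (node n).1.
Definition corner n : edge -> R := (node n).2.
Definition side_dir q := side q (dir (owner q)).
Definition parent n := owner (n %/ 3).

Lemma nodeS n : node n.+1 = child n (node (parent n)).
Proof. by rewrite {1}/node /= node_fuelE// owner_le. Qed.

Lemma dirS n : dir n.+1 = side_dir (n %/ 3).
Proof. by rewrite /dir nodeS. Qed.

Lemma select0 (A : Type) i (x y z : A) : select i x y z i = x.
Proof. by case: i. Qed.

Lemma select1 (A : Type) i (x y z : A) : select i x y z (nxt i) = y.
Proof. by case: i. Qed.

Lemma select2 (A : Type) i (x y z : A) : select i x y z (nxt (nxt i)) = z.
Proof. by case: i. Qed.

Lemma corner_shared n :
  corner n.+1 (dir n.+1) = corner (parent n) (dir n.+1).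
Proof. by rewrite /corner /dir nodeS /= select0. Qed.

Lemma corner_far n : corner n.+1 (nxt (dir n.+1)) = scale n.+1.
Proof. by rewrite /corner /dir nodeS /= select1. Qed.

Lemma tri_sizeS n : tri_size (corner n.+1) = - tri_size (corner (parent n)) / 3.
Proof.
rewrite (tri_sizeE _ (dir n.+1)) corner_shared corner_far.
by rewrite /corner /dir nodeS /= select2; field.
Qed.

Lemma tri_size0 : tri_size (corner 0) = 1.
Proof. by rewrite /tri_size /corner /node /=; ring. Qed.

Lemma tri_size_neq0_le1 n : tri_size (corner n) != 0 /\ `|tri_size (corner n)| <= 1.
Proof.
elim/ltn_ind: n => -[_|n IH]; first by rewrite tri_size0 oner_eq0 normr1.
have [s0 s1] := IH (parent n) (owner_le n).
rewrite tri_sizeS mulNr oppr_eq0 mulf_neq0 ?invr_eq0 ?pnatr_eq0//; split => //.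
by rewrite normrN normrM normfV normr_nat; lra.
Qed.

Lemma scaleS n : scale n.+1 = (n + 4)%:R * scale n.
Proof. by rewrite /scale addSn factS natrM -addnS. Qed.

Lemma le_scale m n : (m <= n)%N -> scale m <= scale n.
Proof. by move=> mn; rewrite ler_nat; apply: leq_fact; rewrite leq_add2r. Qed.

Lemma scale_ge6 n : 6 <= scale n.
Proof. exact: le_trans (le_scale _ _ (leq0n n)). Qed.

Lemma scaleS_ge n : 4 * scale n <= scale n.+1.
Proof. by rewrite scaleS natrD [leRHS]mulrDl lerDr mulr_ge0. Qed.

Lemma corner_le n j : `|corner n j| <= 2 * scale n.
Proof.
elim/ltn_ind: n j => -[_|n IH] j.
  by case: j; rewrite /corner /node /= ?normr0 ?normrN ?normr1; have := scale_ge6 0; lra.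
have := le_trans (IH _ (owner_le n : (parent n < n.+1)%N) (dir n.+1)) _.
move=> /(_ (2 * scale n)); rewrite ler_pM2l// => /(_ (le_scale _ _ (owner_le n))).
rewrite -corner_shared => c0; have M4 := scaleS_ge n; have M6 := scale_ge6 n.
have [_ s1] := tri_size_neq0_le1 n.+1.
case: (edge3P (dir n.+1) j) => ->.
- by apply: (le_trans c0); lra.
- by rewrite corner_far ger0_norm; lra.
have := tri_sizeE (corner n.+1) (dir n.+1).
move: c0 s1; rewrite corner_far !ler_norml => /andP[? ?] /andP[? ?] ?.
by apply/andP; split; lra.
Qed.

Lemma corner_shared_le n : `|corner n.+1 (dir n.+1)| <= 2 * scale n.
Proof.
rewrite corner_shared; apply: (le_trans (corner_le _ _)).
by rewrite ler_pM2l// le_scale// owner_le.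
Qed.

Definition piece n := triangle (corner n).

Lemma piece_coord n q j : piece n q -> `|coord j q - corner n j| <= 1.
Proof.
move=> /(triangle_coord _ _ j) /le_trans; apply.
by have [] := tri_size_neq0_le1 n.
Qed.

Lemma piece_coord_le n q j : piece n q -> `|coord j q| <= 2 * scale n + 1.
Proof.
move=> /(piece_coord _ _ j); have := corner_le n j.
by rewrite !ler_norml => /andP[? ?] /andP[? ?]; apply/andP; split; lra.
Qed.

(** The coordinate along which a triangle was moved is far larger on it than
    on all earlier triangles. *)
Lemma trivIset_piece : trivIset setT piece.
Proof.
have lt_disj m n q : (m < n)%N -> piece m q -> piece n q -> False.
  case: n => // n; rewrite ltnS => mn /(piece_coord_le _ _ (nxt (dir n.+1))).
  move=> qm /(piece_coord _ _ (nxt (dir n.+1))); rewrite corner_far.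
  have := scaleS_ge n; have := scale_ge6 n; have := le_scale _ _ mn.
  by move: qm; rewrite !ler_norml => /andP[? ?] ? ? ? /andP[? ?]; lra.
apply/trivIsetP => m n _ _ mn; apply/seteqP; split => // q [qm qn].
by case: (ltngtP m n) mn => // /lt_disj h _; [apply: h qm qn|apply: h qn qm].
Qed.

(** The sides of one triangle have different directions. *)
Lemma side_dir_inj q q' :
  owner q = owner q' -> side_dir q = side_dir q' -> q = q'.
Proof.
have small p p' : owner p.+1 = owner p'.+1 ->
    side_dir p.+1 = side_dir p'.+1 -> p.+1 = p'.+1.
  rewrite /side_dir => e; rewrite -e /side /= => d.
  have o : odd p = odd p' by move: d; do 2 case: odd => //=; case: (dir _).
  by rewrite -(odd_double_half p) -(odd_double_half p') o (e : p./2 = p'./2).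
have zero p : owner p.+1 = 0%N -> side_dir p.+1 <> Edge0.
  rewrite /side_dir => ->; rewrite /side (_ : dir 0 = Edge0)//.
  by case: ifP.
case: q => [|q]; case: q' => [|q'] //; last exact: small.
  by move=> o0 /esym /zero; case.
by move=> /zero.
Qed.

(** The edge across which a triangle was attached is compensated by its
    parent; it is not one of the sides that receive children. *)
Lemma side_dir_neq n q : (0 < n)%N -> owner q = n -> side_dir q <> dir n.
Proof.
case: q => [|q]; first by rewrite /owner /= => + e; rewrite -e.
by move=> _ e; rewrite /side_dir e /side; case: ifP => _; case: (dir n).
Qed.

Lemma side_exists n j : (0 < n)%N -> j <> dir n ->
  exists2 q, owner q = n & side_dir q = j.
Proof.
move=> n0 jn; have [|j1|j2] := edge3P (dir n) j => //.
  by exists n.*2.+1; rewrite /side_dir /owner /= ?odd_double ?doubleK.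
exists n.*2.+2; rewrite /side_dir /owner /= ?odd_double /= ?uphalf_double//.
Qed.

Lemma root_side_exists j : exists2 q, owner q = 0%N & side_dir q = j.
Proof. by case: j; [exists 0%N|exists 1%N|exists 2%N]. Qed.

End Tree.

(** * Area *)

Section Area.
Context {R : realType}.
Let plane := (measurableTypeR R * measurableTypeR R)%type.

Lemma measurable_coord i :
  measurable_fun [set: plane] (@coord R i : plane -> measurableTypeR R).
Proof.
have m1 : measurable_fun [set: plane] (fst : plane -> measurableTypeR R).
  exact: measurable_fst.
have m2 : measurable_fun [set: plane] (snd : plane -> measurableTypeR R).
  exact: measurable_snd.
case: i => //=; apply: measurable_funB => //; exact: measurableT_comp.
Qed.

Lemma measurable_triangle c : measurable (triangle c : set plane).
Proof.
have half i : measurable [set q : plane | (c i <= coord i q) = (0 < tri_size c)].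
  have mi : measurable [set q : plane | c i <= coord i q].
    rewrite -[X in measurable X]setTI.
    rewrite (_ : [set q : plane | _] = @coord R i @^-1` `[c i, +oo[).
      by apply: measurable_coord => //; exact: measurable_itv.
    by apply/seteqP; split => q /=; rewrite in_itv/= andbT.
  case: (0 < tri_size c); first exact: mi.
  rewrite (_ : [set q | _] = ~` [set q : plane | c i <= coord i q]).
    exact: measurableC.
  by apply/seteqP; split => q /=; [move=> ->|move/negP/negbTE].
rewrite (_ : triangle c = [set q : plane | (c Edge0 <= coord Edge0 q) = (0 < tri_size c)]
  `&` [set q : plane | (c Edge1 <= coord Edge1 q) = (0 < tri_size c)]
  `&` [set q : plane | (c Edge2 <= coord Edge2 q) = (0 < tri_size c)]).
  by apply: measurableI => //; apply: measurableI.
apply/seteqP; split => q; first by move=> h; split; [split|]; apply: h.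
by move=> [[h0 h1] h2] []; [exact: h0|exact: h1|exact: h2].
Qed.

Lemma borel_lebesgue2_box (a b r : R) : 0 <= r ->
  borel_lebesgue2 (`[a, a + r] `*` `[b, b + r]) = (r ^+ 2)%:E.
Proof.
move=> r0; apply: etrans (product_measure1E _ _ _ _) _ => //.
have len (x : R) : lebesgue_measure `[x, x + r] = r%:E.
  rewrite lebesgue_measure_itv/= lte_fin; case: ltP => [_|].
    by rewrite -EFinB addrAC subrr add0r.
  by rewrite gerDl => r0'; congr EFin; apply/eqP; rewrite eq_le r0 r0'.
by rewrite [X in (X * _)%E]len [X in (_ * X)%E]len -EFinM.
Qed.

Lemma triangle_area (c : edge -> R) :
  (borel_lebesgue2 (triangle c) <= (4 * tri_size c ^+ 2)%:E)%E.
Proof.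
pose r : R := `|tri_size c| *+ 2.
have r0 : 0 <= r by rewrite mulrn_wge0.
have -> : 4 * tri_size c ^+ 2 = r ^+ 2.
  by rewrite -[tri_size c ^+ 2]real_normK ?num_real// /r; ring.
rewrite -(borel_lebesgue2_box (c Edge0 - `|tri_size c|) (c Edge1 - `|tri_size c|) r r0).
apply: le_measure.
- by rewrite inE; apply: measurable_triangle.
- by rewrite inE; apply: measurableX; exact: measurable_itv.
move=> q Tq; have := triangle_coord _ _ Edge0 Tq.
have := triangle_coord _ _ Edge1 Tq; rewrite /= !ler_norml.
move=> /andP[? ?] /andP[? ?]; split => /=; rewrite in_itv/= /r mulr2n.
  by apply/andP; split; lra.
by apply/andP; split; lra.
Qed.

Lemma sum_div (F : nat -> R) k n : (0 < k)%N ->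
  \sum_(i < k * n) F (i %/ k)%N = k%:R * \sum_(j < n) F j.
Proof.
move=> k0; elim: n => [|n IH]; first by rewrite muln0 !big_ord0 mulr0.
rewrite mulnS addnC big_split_ord/= IH big_ord_recr/= mulrDr; congr (_ + _).
rewrite (eq_bigr (fun=> F n)); first by rewrite sumr_const card_ord mulr_natl.
by move=> i _; rewrite mulnC divnMDl// divn_small ?addn0.
Qed.

(** Let S be the sum for n nodes.  The first 6 n + 4 nodes are the root, its
    three children across the side 0, and the six children of each of the
    first n nodes across the two other sides, so their sum is 4/3 + 2/3 S.
    It is at least S, which forces S to be at most 4. *)
Lemma sum_tri_size n : \sum_(i < n) tri_size (@corner R i) ^+ 2 <= 4.
Proof.
pose a i := tri_size (@corner R i) ^+ 2.
have a0 i : 0 <= a i by rewrite sqr_ge0.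
rewrite -[X in X <= _]/(\sum_(i < n) a i).
have big : \sum_(i < n) a i <= \sum_(i < (3 * (2 * n).+1).+1) a i.
  have -> : (3 * (2 * n).+1).+1 = (n + (5 * n + 4))%N by lia.
  by rewrite big_split_ord/= lerDl sumr_ge0.
have : \sum_(i < (3 * (2 * n).+1).+1) a i = 4 / 3 + 2 / 3 * \sum_(i < n) a i.
  rewrite big_ord_recl/= (eq_bigr (fun i : 'I_ _ => a (owner (i %/ 3)) / 9)).
    rewrite (sum_div (fun q => a (owner q) / 9))// big_ord_recl /=.
    rewrite (eq_bigr (fun i : 'I_ _ => a (i %/ 2)%N / 9)).
      rewrite (sum_div (fun q => a q / 9))// -mulr_suml.
      rewrite /owner /= /a tri_size0; lra.
    by move=> i _; rewrite /owner /= divn2.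
  by move=> i _; rewrite /a tri_sizeS /parent; field.
lra.
Qed.

Lemma measurable_union_pieces :
  measurable (\bigcup_n piece n : set plane).
Proof. by apply: bigcupT_measurable => n; apply: measurable_triangle. Qed.

Lemma lebesgue2_measurable_union_pieces :
  lebesgue2_measurable (\bigcup_n @piece R n).
Proof.
apply: sub_caratheodory; apply: sub_sigma_algebra.
exact: measurable_union_pieces.
Qed.

Lemma lebesgue2_union_pieces :
  (0 < lebesgue2 (\bigcup_n @piece R n) < +oo)%E.
Proof.
rewrite /lebesgue2 /completed_measure_extension /=.
rewrite measurable_mu_extE; last exact: measurable_union_pieces.
apply/andP; split.
  pose half : R := 1 / 2.
  apply: (@lt_le_trans _ _ (borel_lebesgue2 (`[0%R, 0%R + half] `*` `[0%R, 0%R + half]))).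
    by rewrite borel_lebesgue2_box ?lte_fin ?exprn_gt0 ?divr_ge0 ?divr_gt0.
  apply: le_measure; rewrite ?inE.
  - by apply: measurableX; exact: measurable_itv.
  - exact: measurable_union_pieces.
  move=> q [/=]; rewrite !in_itv/= add0r /half => /andP[? ?] /andP[? ?].
  exists 0%N => // i; rewrite tri_size0 ltr01.
  by case: i; rewrite /corner /node /=; lra.
apply: (@le_lt_trans _ _ 16%:E); last by rewrite ltry.
apply: (@le_trans _ _ (\sum_(n <oo) borel_lebesgue2 (piece n))%E).
  apply: measure_sigma_subadditive => //.
  - by move=> n; apply: measurable_triangle.
  - exact: measurable_union_pieces.
apply: lime_le; first by apply: is_cvg_nneseries => *; apply: measure_ge0.
apply: nearW => n; rewrite big_mkord.
apply: (@le_trans _ _ (\sum_(i < n) (4 * tri_size (@corner R i) ^+ 2)%:E)%E).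
  by apply: lee_sum => i _; apply: triangle_area.
rewrite sumEFin lee_fin -mulr_sumr; have := sum_tri_size n; lra.
Qed.

End Area.

(** * Directions orthogonal to no edge *)

Section Directions.
Context {R : realType}.
Implicit Types (w q : R * R) (i j : edge).

Lemma rot_neq0 w : unit_circle w -> forall i,
  coord i (rot w) = 0 -> coord (nxt i) (rot w) != 0.
Proof.
rewrite /unit_circle /= /dotp => w1 i wi; apply/eqP => wj; move: w1.
have [-> ->] : w.1 = 0 /\ w.2 = 0 by case: i wi wj => /= ? ?; split; lra.
by rewrite !mulr0 addr0 => /esym/eqP; rewrite oner_eq0.
Qed.

Lemma unit_circle_le1 w : unit_circle w -> `|w.1| <= 1 /\ `|w.2| <= 1.
Proof.
rewrite /unit_circle /= /dotp => w1; rewrite !ler_norml.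
by split; apply/andP; split; nra.
Qed.

Definition dot_coef i w : R :=
  match i with Edge0 => w.1 | Edge1 => w.2 - w.1 | Edge2 => - w.2 end.

(** The displacement of a triangle along the edge line of index i changes
    only the second term, so it is seen in direction w unless
    [coord i (rot w)] vanishes. *)
Lemma dotp_coord i q w :
  dotp q w = dot_coef i w * coord i q - coord i (rot w) * coord (nxt i) q.
Proof. by case: i => /=; rewrite /dotp; ring. Qed.

Lemma dot_coef_le2 i w : unit_circle w -> `|dot_coef i w| <= 2.
Proof.
move=> /unit_circle_le1; rewrite !ler_norml => -[/andP[? ?] /andP[? ?]].
by apply/andP; case: i => /=; split; lra.
Qed.

Lemma min_lipschitz (a b a' b' e : R) : `|a - a'| <= e -> `|b - b'| <= e ->
  `|Num.min a b - Num.min a' b'| <= e.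
Proof.
rewrite !ler_norml => /andP[? ?] /andP[? ?].
by case: (leP a b) => ?; case: (leP a' b') => ?; apply/andP; split; lra.
Qed.

Lemma max0_lipschitz (a a' e : R) : `|a - a'| <= e ->
  `|Num.max 0 a - Num.max 0 a'| <= e.
Proof.
rewrite !ler_norml => /andP[? ?].
by case: (leP 0 a) => ?; case: (leP 0 a') => ?; apply/andP; split; lra.
Qed.

Lemma odd_sign (a : edge -> R) : a Edge0 + a Edge1 + a Edge2 = 0 ->
  (forall i, a i != 0) -> exists i, a i * a (nxt i) < 0 /\ a i * a (nxt (nxt i)) < 0.
Proof.
move=> a0 an.
have sgn i : (0 < a i) \/ (a i < 0).
  by case: (ltgtP (a i) 0) (an i) => // ? _; [right|left].
case: (sgn Edge0) => s0; case: (sgn Edge1) => s1; case: (sgn Edge2) => s2;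
  try lra;
  solve [exists Edge0; split => /=; nra | exists Edge1; split => /=; nra
        | exists Edge2; split => /=; nra].
Qed.

Lemma piece_dotp_le n q w : unit_circle w -> piece n q ->
  `|dotp q w| <= 4 * scale n + 2.
Proof.
move=> /unit_circle_le1[w1 w2] qn.
have q1 := piece_coord_le _ _ Edge0 qn; have q2 := piece_coord_le _ _ Edge1 qn.
rewrite /dotp; apply: (le_trans (ler_normD _ _)); rewrite !normrM.
have h1 := ler_pM (normr_ge0 _) (normr_ge0 _) q1 w1.
have h2 := ler_pM (normr_ge0 _) (normr_ge0 _) q2 w2.
by move: h1 h2 => /=; lra.
Qed.

(** Along the shared edge line the triangle is at distance scale (n + 1);
    everything else is controlled by the scale of the earlier nodes. *)
Lemma piece_dotp_ge n q w : unit_circle w -> piece n.+1 q ->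
  `|coord (@dir R n.+1) (rot w)| * ((n + 4)%:R * scale n - 1)
    - (4 * scale n + 2) <= `|dotp q w|.
Proof.
move=> w1 qn; set i := @dir R n.+1.
have ci := @corner_shared_le R n; have g2 := dot_coef_le2 i w w1.
have qi := piece_coord _ _ i qn; have qj := piece_coord _ _ (nxt i) qn.
rewrite corner_far scaleS in qj.
have qi' : `|coord i q| <= 2 * scale n + 1.
  by move: qi ci; rewrite !ler_norml => /andP[? ?] /andP[? ?]; apply/andP; split; lra.
rewrite (dotp_coord i) distrC; apply: le_trans (lerB_dist _ _).
rewrite !normrM; apply: lerB.
  apply: ler_wpM2l => //; apply: le_trans (ler_norm _).
  by move: qj; rewrite ler_norml => /andP[? ?]; lra.
have := ler_pM (normr_ge0 _) (normr_ge0 _) g2 qi'; lra.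
Qed.

(** The slopes of the affine functions that give the length of a section
    depend on w and on the edge index, and not on the triangle.  Since the
    growth rate of the scales exceeds 12 / kappa eventually, where kappa is
    the least absolute value of a slope beta, the projections of late triangles are
    disjoint. *)
Lemma Lip_transversal w : unit_circle w ->
  (forall i, coord i (rot w) != 0) -> (Lip (\bigcup_n piece n) w < +oo)%E.
Proof.
move=> w1 wn; pose beta i := coord i (rot w).
have [|i [i1 i2]] := odd_sign beta _ wn; first by rewrite /beta /=; ring.
pose r n t j := (corner n j - t * coord j w) / beta j.
pose g n t := if (0 < beta i) == (0 < tri_size (@corner R n))
  then Num.min (r n t (nxt i) - r n t i) (r n t (nxt (nxt i)) - r n t i)
  else Num.min (r n t i - r n t (nxt i)) (r n t i - r n t (nxt (nxt i))).
pose K0 j := `|coord j w / beta j|.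
pose K := K0 i + K0 (nxt i) + K0 (nxt (nxt i)).
have K00 j : 0 <= K0 j by exact: normr_ge0.
have sect n t : exists l h,
    line_point w t @^-1` piece n = segment (0 < tri_size (@corner R n)) l h /\
    h - l = g n t by exact: triangle_section_transversal.
have rK n j t t' : `|r n t j - r n t' j| <= K0 j * `|t - t'|.
  rewrite /K0 -normrM -normrN le_eqVlt; apply/orP; left; apply/eqP.
  by congr `|_|; rewrite /r; ring.
have rrK n t t' j k : K0 j + K0 k <= K ->
    `|(r n t j - r n t k) - (r n t' j - r n t' k)| <= K * `|t - t'|.
  move=> jk; apply: (@le_trans _ _ ((K0 j + K0 k) * `|t - t'|)); last first.
    exact: ler_wpM2r.
  rewrite mulrDl (_ : _ - _ = (r n t j - r n t' j) - (r n t k - r n t' k)).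
    by apply: (le_trans (ler_normB _ _)); apply: lerD.
  by ring.
pose kappa := Num.min `|beta Edge0| (Num.min `|beta Edge1| `|beta Edge2|).
have kappa0 : 0 < kappa by rewrite !lt_min !normr_gt0 /beta !wn.
have kappa_le j : kappa <= `|beta j|.
  by case: j; rewrite !ge_min lexx ?orbT.
pose N := Num.truncn (12 / kappa).
have sep m n x y : (m <= n)%N -> (N <= n)%N -> piece m x -> piece n.+1 y ->
    `|dotp x w| < `|dotp y w|.
  move=> mn Nn xm yn; apply: (le_lt_trans (piece_dotp_le _ _ _ w1 xm)).
  apply: lt_le_trans (piece_dotp_ge _ _ _ w1 yn).
  have M6 := @scale_ge6 R n; have Mmn := @le_scale R _ _ mn.
  have kn : 12 < kappa * n.+1%:R.
    rewrite mulrC -ltr_pdivrMr//; apply: lt_le_trans (truncnS_gt _) _.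
    by rewrite ler_nat.
  have h : kappa * (n.+1%:R * scale n) <=
      `|beta (@dir R n.+1)| * ((n + 4)%:R * scale n - 1).
    apply: ler_pM => //; first exact: ltW.
      by rewrite mulr_ge0//; lra.
    by rewrite -addn1 !natrD; nra.
  have : 12 * scale n < kappa * (n.+1%:R * scale n).
    by rewrite mulrA ltr_pM2r//; lra.
  by move: h; rewrite /beta; lra.
apply: (@Lip_lt_pinfty_pieces _ _ piece (fun n t => Num.max 0 (g n t)) _ K N.+1) => //.
- by rewrite !addr_ge0.
- exact: trivIset_piece.
- by move=> n t; have [l [h [-> _]]] := sect n t; exact: segment_measurable.
- by move=> n t; have [l [h [-> <-]]] := sect n t; exact: segment_measure.
- move=> n t t'; apply: max0_lipschitz; rewrite /g.
  by case: ifP => _; apply: min_lipschitz; apply: rrK;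
    have := (K00 i, K00 (nxt i), K00 (nxt (nxt i))) => -[[? ?] ?]; rewrite /K; lra.
move=> m n x y Nm Nn xm yn xy; apply/eqP; case: ltngtP => // mn.
  case: n Nn mn yn => // n; rewrite !ltnS => Nn mn yn.
  by have := sep _ _ _ _ mn Nn xm yn; rewrite xy ltxx.
case: m Nm mn xm => // m; rewrite !ltnS => Nm nm xm.
by have := sep _ _ _ _ nm Nm yn xm; rewrite xy ltxx.
Qed.

End Directions.

(** * Directions orthogonal to an edge *)

Section Parallel.
Context {R : realType}.
Variables (w : R * R) (j : edge).
Hypotheses (w1 : unit_circle w) (wj : coord j (rot w) = 0).

Let beta := `|coord (nxt j) (rot w)|.

Let beta_gt0 : 0 < beta.
Proof. by rewrite normr_gt0 (rot_neq0 _ w1). Qed.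

(** Enumerates the four triangles of a cluster by k < 4. *)
Definition member (q k : nat) : nat :=
  if k is k'.+1 then (3 * q + k').+1 else owner q.

(** Only the sides of direction j are used: each triangle then lies in exactly
    one cluster, as a child if it was attached across an edge of direction j,
    and as an owner otherwise. *)
Definition cluster (q : nat) : set (R * R) :=
  if `[< @side_dir R q = j >] then
    piece (member q 0) `|` piece (member q 1) `|` piece (member q 2)
    `|` piece (member q 3)
  else set0.

Lemma memberS q k : (k < 3)%N -> @side_dir R q = j ->
  [/\ @dir R (member q k.+1) = j,
      corner (member q k.+1) j = corner (owner q) j :> R &
      tri_size (corner (member q k.+1)) = - tri_size (corner (owner q)) / 3 :> R].
Proof.
move=> k3 qj; have q3 : ((3 * q + k) %/ 3 = q)%N.
  by rewrite mulnC divnMDl// divn_small// addn0.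
rewrite /member dirS q3 tri_sizeS /parent q3; split=> //.
by have := @corner_shared R (3 * q + k); rewrite dirS /parent q3 qj.
Qed.

Lemma member_inj q q' k k' : (k < 4)%N -> (k' < 4)%N ->
  @side_dir R q = j -> @side_dir R q' = j ->
  member q k = member q' k' -> q = q' /\ k = k'.
Proof.
have mixed p p' l : (l < 3)%N -> @side_dir R p = j -> @side_dir R p' = j ->
    owner p' <> member p l.+1.
  move=> l3 pj p'j /(@side_dir_neq R); rewrite p'j; apply => //.
  by have [-> _ _] := memberS _ _ l3 pj.
case: k k' => [|k] [|k'] // k4 k4' qj q'j.
- by move=> /(@side_dir_inj R) h; split => //; apply: h; rewrite qj.
- by move=> /mixed; case.
- by move=> /esym /mixed; case.
by rewrite /member => -[?]; split; lia.
Qed.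

Lemma clusterP q x : cluster q x <->
  @side_dir R q = j /\ exists2 k, (k < 4)%N & piece (member q k) x.
Proof.
rewrite /cluster; case: asboolP => [qj|qj]; last by split => // -[].
split.
  by move=> [[[|]|]|] h; split => //; [exists 0%N|exists 1%N|exists 2%N|exists 3%N].
move=> [_ [[|[|[|[|//]]]] _ h]]; [left; left; left|left; left; right|left; right|right];
  exact: h.
Qed.

Lemma piece_eq m n (x : R * R) : piece m x -> piece n x -> m = n.
Proof.
move=> mx nx; apply/eqP/negPn/negP => mn.
have /trivIsetP/(_ m n I I mn) := @trivIset_piece R.
by move/seteqP => -[/(_ x)] + _; apply.
Qed.

Lemma trivIset_cluster : trivIset setT cluster.
Proof.
apply/trivIsetP => q q' _ _ /eqP qq'; apply/seteqP; split => // x [].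
move=> /clusterP[qj [k k4 xk]] /clusterP[q'j [k' k4' xk']].
by have [/qq'] := member_inj _ _ _ _ k4 k4' qj q'j (piece_eq _ _ _ xk xk').
Qed.

Lemma cluster_cover : \bigcup_n piece n = \bigcup_q cluster q.
Proof.
apply/seteqP; split => x; last first.
  by move=> [q _ /clusterP[_ [k _ xk]]]; exists (member q k).
move=> [n _ xn].
suff [q [k [k4 qj nE]]] : exists q k, [/\ (k < 4)%N, @side_dir R q = j & n = member q k].
  by exists q => //; apply/clusterP; split => //; exists k; rewrite -?nE.
case: n xn => [|n] _.
  by have [q <- qj] := @root_side_exists R j; exists q, 0%N.
have [nj|nj] := pselect (@dir R n.+1 = j); last first.
  have [q <- qj] := @side_exists R n.+1 j isT (fun e => nj (esym e)).
  by exists q, 0%N.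
exists (n %/ 3)%N, (n %% 3).+1; rewrite -(@dirS R) nj; split => //.
  by rewrite ltnS ltn_pmod.
by rewrite /member mulnC -divn_eq.
Qed.

Let section_len n t : R :=
  if (corner n j <= t * coord j w) == (0 < tri_size (@corner R n))
  then Num.max 0 ((`|tri_size (corner n)| - `|t * coord j w - corner n j|) / beta)
  else 0.

Lemma piece_section n t :
  measurable (line_point w t @^-1` piece n : set (measurableTypeR R)) /\
  lebesgue_measure (line_point w t @^-1` piece n) = (section_len n t)%:E.
Proof.
have [l [h [E len]]] := triangle_section_parallel (corner n) w t j wj (rot_neq0 _ w1 _ wj).
rewrite [_ @^-1` _]E /section_len; case: eqP len => [e /(_ e) len|_ _].
  by rewrite /beta -len; split; [exact: segment_measurable|exact: segment_measure].
by rewrite measure0.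
Qed.

(* v is the distance of the line from the edge of direction j, counted
   positively on the side of the owner. *)
Let cluster_len q t : R :=
  let s := tri_size (@corner R (owner q)) in
  let v := (if 0 < s then 1 else -1) * (t * coord j w - corner (owner q) j) in
  if `[< @side_dir R q = j >] then
    Num.max 0 (Num.min ((`|s| - v) / beta) ((`|s| + 3 * v) / beta))
  else 0.

(** Here the jumps cancel.  With x the length of the common edge and y
    proportional to the distance of the line from it, the owner contributes
    x - y on its side of the edge, and each of the three children x / 3 - y on
    the other side, wherever these are positive.  Since 3 (x / 3 - y) equals
    x - 3 y, the sum is the positive part of a minimum of two affine functions
    that takes the value x on the edge line. *)
Lemma cluster_lenE q t : @side_dir R q = j ->
  cluster_len q t = section_len (member q 0) t + section_len (member q 1) t
    + section_len (member q 2) t + section_len (member q 3) t.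
Proof.
move=> qj; rewrite /cluster_len asboolT//.
have [_ c1 s1] := memberS q 0 isT qj.
have [_ c2 s2] := memberS q 1 isT qj.
have [_ c3 s3] := memberS q 2 isT qj.
rewrite /section_len c1 c2 c3 s1 s2 s3 {c1 c2 c3 s1 s2 s3} [member q 0]/=.
have [s0 _] := @tri_size_neq0_le1 R (owner q).
move: (tri_size _) (corner _ j) s0 => s c s0; set d := t * coord j w - c.
rewrite !mulNr normrN normrM normfV normr_nat oppr_gt0.
have -> : (s / 3 < 0) = ~~ (0 < s).
  by rewrite pmulr_llt0 ?invr_gt0// -leNgt lt_neqAle s0.
have -> : (c <= t * coord j w) = (0 <= d) by rewrite subr_ge0.
set p := (0 <= d) == (0 < s).
have -> : ((0 <= d) == ~~ (0 < s)) = ~~ p.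
  by rewrite /p; case: (0 <= d); case: (0 < s).
have -> : (if 0 < s then 1 else -1) * d = if p then `|d| else - `|d|.
  rewrite /p; have [d0|d0] := leP 0 d; rewrite ?(ger0_norm d0) ?(ltr0_norm d0);
    by case: (0 < s); rewrite /= ?mul1r ?mulN1r ?opprK.
have B0 : beta != 0 by rewrite gt_eqF.
set x := `|s| / beta; have x0 : 0 <= x by rewrite divr_ge0// ltW.
set y := `|d| / beta; have y0 : 0 <= y by rewrite divr_ge0// ltW.
have -> : (`|s| / 3 - `|d|) / beta = x / 3 - y by rewrite /x /y; field.
have -> : (`|s| - `|d|) / beta = x - y by rewrite /x /y; field.
case: p => /=.
  have -> : (`|s| - `|d|) / beta = x - y by rewrite /x /y; field.
  have -> : (`|s| + 3 * `|d|) / beta = x + 3 * y by rewrite /x /y; field.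
  by rewrite !addr0 min_l//; lra.
have -> : (`|s| + 3 * - `|d|) / beta = x - 3 * y by rewrite /x /y; field.
have -> : (`|s| - - `|d|) / beta = x + y by rewrite /x /y; field.
rewrite add0r min_r; last by lra.
by case: (leP 0 (x - 3 * y)) => ?; case: (leP 0 (x / 3 - y)) => ?; lra.
Qed.

Lemma cluster_section q t :
  measurable (line_point w t @^-1` cluster q : set (measurableTypeR R)) /\
  lebesgue_measure (line_point w t @^-1` cluster q) = (cluster_len q t)%:E.
Proof.
case: (pselect (@side_dir R q = j)) => qj; last first.
  by rewrite /cluster /cluster_len asboolF// preimage_set0 measure0.
rewrite cluster_lenE// /cluster asboolT//.
have P k := piece_section (member q k) t.
have disj k l : (k < 4)%N -> (l < 4)%N -> k != l ->
    (line_point w t @^-1` piece (member q k)) `&`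
    (line_point w t @^-1` piece (member q l)) = set0.
  move=> k4 l4 /eqP kl; apply/seteqP; split => // u [uk ul].
  by have [_ /kl] := member_inj _ _ _ _ k4 l4 qj qj (piece_eq _ _ _ uk ul).
have union4 (A B C D : set (measurableTypeR R)) :
    measurable A -> measurable B -> measurable C -> measurable D ->
    A `&` B = set0 -> A `&` C = set0 -> A `&` D = set0 ->
    B `&` C = set0 -> B `&` D = set0 -> C `&` D = set0 ->
    lebesgue_measure (A `|` B `|` C `|` D) =
    (lebesgue_measure A + lebesgue_measure B + lebesgue_measure C
      + lebesgue_measure D)%E.
  move=> mA mB mC mD AB AC AD BC BD CD.
  have mAB := measurableU _ _ mA mB.
  rewrite measureU ?measureU//; last 2 first.
  - exact: measurableU.
  - by rewrite !setIUl AD BD CD !setU0.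
  - by rewrite setIUl AC BC setU0.
rewrite !preimage_setU.
have [m0 e0] := P 0%N; have [m1 e1] := P 1%N.
have [m2 e2] := P 2%N; have [m3 e3] := P 3%N.
split; first by do 3! apply: measurableU => //.
rewrite union4 ?disj// e0 e1 e2 e3.
by rewrite !EFinD.
Qed.

Lemma cluster_len_lipschitz q t t' :
  `|cluster_len q t - cluster_len q t'| <=
  3 * `|coord j w| / beta * `|t - t'|.
Proof.
rewrite /cluster_len; case: asboolP => [_|_]; last first.
  by rewrite subrr normr0 mulr_ge0// divr_ge0 ?mulr_ge0// ltW.
set s := tri_size _; set sg : R := if _ then _ else _; set c := corner _ _.
have sg1 : `|sg| = 1 by rewrite /sg; case: ifP; rewrite ?normrN normr1.
have K x : `|x| <= 3 ->
    `|x * sg * (t - t') * coord j w / beta| <= 3 * `|coord j w| / beta * `|t - t'|.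
  move=> x3; rewrite !normrM sg1 mulr1 normfV (gtr0_norm beta_gt0).
  rewrite [leRHS](_ : _ = 3 * (`|coord j w| / beta * `|t - t'|)); last by ring.
  rewrite [leLHS](_ : _ = `|x| * (`|coord j w| / beta * `|t - t'|)); last by ring.
  by rewrite ler_wpM2r// mulr_ge0// divr_ge0// ltW.
apply: max0_lipschitz; apply: min_lipschitz.
  rewrite [X in `|X|](_ : _ = (-1) * sg * (t - t') * coord j w / beta); last by ring.
  by apply: K; rewrite normrN normr1; lra.
rewrite [X in `|X|](_ : _ = 3 * sg * (t - t') * coord j w / beta); last by ring.
by apply: K; rewrite ger0_norm.
Qed.

Lemma cluster_coord q x : cluster q x -> `|coord j x - corner (owner q) j| <= 1.
Proof.
move=> /clusterP[qj [[|k] k4 xk]]; first exact: piece_coord xk.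
by have [_ <- _] := memberS q k k4 qj; apply: piece_coord xk.
Qed.

Lemma corner_transversal_ge n : @dir R n.+1 <> j ->
  (n + 2)%:R * scale n - 1 <= `|@corner R n.+1 j|.
Proof.
move=> nj; have M6 := @scale_ge6 R n; have ci := @corner_shared_le R n.
have [_ s1] := @tri_size_neq0_le1 R n.+1.
have SE := tri_sizeE (@corner R n.+1) (@dir R n.+1).
have M : scale n.+1 = (n + 2)%:R * scale n + 2 * scale n :> R.
  by rewrite scaleS -mulrDl -natrD -addnA.
have [jE|->|->] := edge3P (@dir R n.+1) j; first by rewrite jE in nj.
  by rewrite corner_far M; apply: le_trans (ler_norm _); lra.
rewrite corner_far M in SE; rewrite -normrN; apply: le_trans (ler_norm _).
by move: ci s1; rewrite !ler_norml => /andP[? ?] /andP[? ?]; lra.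
Qed.

(** For lines of direction j the position of a cluster is that of its owner,
    which was attached across an edge of another direction and hence moved
    transversally to these lines. *)
Lemma cluster_separated q q' x y : (owner q < owner q')%N -> (0 < owner q)%N ->
  cluster q x -> cluster q' y -> dotp x w <> dotp y w.
Proof.
move=> qq' q0 xq yq'; rewrite !(dotp_coord j) wj !mul0r !subr0 => xy.
have gn : dot_coef j w != 0.
  apply/eqP => g0; move: (w1); rewrite /unit_circle/= (dotp_coord j) g0 wj.
  by rewrite !mul0r subr0 => /esym/eqP; rewrite oner_eq0.
have {}xy := mulfI gn xy.
have := cluster_coord _ _ yq'; have := cluster_coord _ _ xq; rewrite xy.
have [q'j _] := (clusterP _ _).1 yq'.
have n'j : @dir R (owner q') <> j.
  move=> e; apply: (@side_dir_neq R (owner q') q') => //; last by rewrite q'j.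
  exact: leq_ltn_trans qq'.
case: (owner q') qq' n'j => // n'; rewrite ltnS => nn' /corner_transversal_ge.
have := @corner_le R (owner q) j; have := @le_scale R _ _ nn'.
have := @scale_ge6 R n'.
have : 3%:R <= (n' + 2)%:R :> R by rewrite ler_nat addn2 !ltnS (leq_trans q0).
move=> n3 M6 Mn' cn cn' h1 h2.
have : 3 * scale n' <= (n' + 2)%:R * scale n' :> R by rewrite ler_wpM2r//; lra.
move: cn'; move: h2 h1 cn; rewrite !ler_norml; move: (corner n'.+1 j) => z.
by case: (leP 0 z) => z0 /andP[? ?] /andP[? ?] /andP[? ?];
  rewrite ?(ger0_norm z0) ?(ltr0_norm z0); lra.
Qed.

Lemma Lip_parallel : (Lip (\bigcup_n piece n) w < +oo)%E.
Proof.
apply: (@Lip_lt_pinfty_pieces _ _ cluster cluster_len _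
  (3 * `|coord j w| / beta) 3) => //.
- by rewrite divr_ge0 ?mulr_ge0// ltW.
- exact: cluster_cover.
- exact: trivIset_cluster.
- by move=> n t; have [] := cluster_section n t.
- by move=> n t; have [] := cluster_section n t.
- exact: cluster_len_lipschitz.
have pos q : (3 <= q)%N -> (0 < owner q)%N by rewrite /owner; lia.
move=> q q' x y q3 q3' xq yq' xy.
have [qj _] := (clusterP _ _).1 xq; have [q'j _] := (clusterP _ _).1 yq'.
case: (ltngtP (owner q) (owner q')) => qq'.
- by case: (cluster_separated _ _ _ _ qq' (pos _ q3) xq yq').
- by case: (cluster_separated _ _ _ _ qq' (pos _ q3') yq' xq).
by apply: (@side_dir_inj R) => //; rewrite qj.
Qed.

End Parallel.

Theorem theorem1 (R : realType) :
  exists E : set (R * R),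
    [/\ lebesgue2_measurable E,
        (0 < lebesgue2 E < +oo)%E &
        forall w : R * R, unit_circle w -> (Lip E w < +oo)%E].
Proof.
exists (\bigcup_n piece n); split.
- exact: lebesgue2_measurable_union_pieces.
- exact: lebesgue2_union_pieces.
move=> w w1; have [[j wj]|wn] := pselect (exists j, coord j (rot w) = 0).
  exact: Lip_parallel w1 wj.
apply: Lip_transversal => // i; apply/eqP => wi; apply: wn; by exists i.
Qed.
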